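(* Let $n\ge0$. A complete metric space $M$ has the $\mathrm{FAP}(n)$-property if and only if every point $z\in M$ has a neighborhood $U_z$ (with the restricted metric) such that $U_z\in\mathrm{FAP}(n)$.
   Context: $\mathbb I=[0,1]$. A metric space $M$ has the fibered approximation property in dimension $n$ ($M\in\mathrm{FAP}(n)$) if for every $\epsilon>0$, every $m\ge0$ and every map $g\colon\mathbb I^m\times\mathbb I^n\to M$ there is a map $g'\colon\mathbb I^m\times\mathbb I^n\to M$ that is $\epsilon$-homotopic to $g$ (there is a homotopy $h$ from $g$ to $g'$ with $\operatorname{diam}h(\{x\}\times\mathbb I)<\epsilon$ for every $x$) and satisfies $\dim g'(\{z\}\times\mathbb I^n)\le n$ for all $z\in\mathbb I^m$. *)

(* Defs.v *)
From Stdlib Require Import Reals Lra List ProofIrrelevance.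
Open Scope R_scope.

Record MetricSpace := {
  pt :> Type;
  dist : pt -> pt -> R;
  dist_nonneg : forall x y, 0 <= dist x y;
  dist_sym : forall x y, dist x y = dist y x;
  dist_refl : forall x, dist x x = 0;
  dist_eq : forall x y, dist x y = 0 -> x = y;
  dist_tri : forall x y z, dist x z <= dist x y + dist y z
}.
Arguments dist {_} _ _.

Definition Cauchy_seq (M : MetricSpace) (s : nat -> M) : Prop :=
  forall eps, 0 < eps -> exists N, forall p q, (N <= p)%nat -> (N <= q)%nat ->
    dist (s p) (s q) < eps.

Definition converges_to (M : MetricSpace) (s : nat -> M) (l : M) : Prop :=
  forall eps, 0 < eps -> exists N, forall p, (N <= p)%nat -> dist (s p) l < eps.

Definition complete (M : MetricSpace) : Prop :=
  forall s : nat -> M, Cauchy_seq M s -> exists l, converges_to M s l.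

Lemma sub_dist_eq (M : MetricSpace) (U : M -> Prop) (x y : {p : M | U p}) :
  dist (proj1_sig x) (proj1_sig y) = 0 -> x = y.
Proof.
  destruct x as [x hx], y as [y hy]; simpl; intro H.
  pose proof (dist_eq M x y H) as E; subst y.
  f_equal; apply proof_irrelevance.
Qed.

Definition subspace (M : MetricSpace) (U : M -> Prop) : MetricSpace :=
  {| pt := {p : M | U p};
     dist := fun a b => dist (proj1_sig a) (proj1_sig b);
     dist_nonneg := fun a b => dist_nonneg M _ _;
     dist_sym := fun a b => dist_sym M _ _;
     dist_refl := fun a => dist_refl M _;
     dist_eq := sub_dist_eq M U;
     dist_tri := fun a b c => dist_tri M _ _ _ |}.

Definition neighborhood (M : MetricSpace) (z : M) (U : M -> Prop) : Prop :=
  exists r, 0 < r /\ forall y, dist z y < r -> U y.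

Definition rel_open (M : MetricSpace) (A U : M -> Prop) : Prop :=
  forall x, A x -> U x -> exists r, 0 < r /\ forall y, A y -> dist x y < r -> U y.

Definition covers (M : MetricSpace) (A : M -> Prop) (Us : list (M -> Prop)) : Prop :=
  forall x, A x -> exists U, In U Us /\ U x.

Definition refines (M : MetricSpace) (A : M -> Prop) (Vs Us : list (M -> Prop)) : Prop :=
  forall V, In V Vs -> exists U, In U Us /\ forall x, A x -> V x -> U x.

(* every point of A lies in at most k members (counted by index) of Vs *)
Definition order_le (M : MetricSpace) (A : M -> Prop) (Vs : list (M -> Prop)) (k : nat) : Prop :=
  forall x, A x -> forall idx : list nat, NoDup idx ->
    (forall i, In i idx -> (i < length Vs)%nat /\ nth i Vs (fun _ => False) x) ->
    (length idx <= k)%nat.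

Definition dim_le (M : MetricSpace) (A : M -> Prop) (n : nat) : Prop :=
  forall Us : list (M -> Prop),
    (forall U, In U Us -> rel_open M A U) -> covers M A Us ->
    exists Vs : list (M -> Prop),
      (forall V, In V Vs -> rel_open M A V) /\ covers M A Vs /\
      refines M A Vs Us /\ order_le M A Vs (S n).

(* The cube I^k = [0,1]^k, as sequences vanishing from index k on *)
Definition cube (k : nat) : Type :=
  {x : nat -> R | forall i, (0 <= x i <= 1) /\ ((k <= i)%nat -> x i = 0)}.

Definition close (k : nat) (x y : cube k) (d : R) : Prop :=
  forall i, (i < k)%nat -> Rabs (proj1_sig x i - proj1_sig y i) < d.

Definition cont_map (M : MetricSpace) (m n : nat) (g : cube m -> cube n -> M) : Prop :=
  forall z y eps, 0 < eps -> exists delta, 0 < delta /\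
    forall z' y', close m z z' delta -> close n y y' delta ->
      dist (g z y) (g z' y') < eps.

(* h : I^m x I^n x I -> M, with time parameter t restricted to [0,1] *)
Definition cont_homotopy (M : MetricSpace) (m n : nat) (h : cube m -> cube n -> R -> M) : Prop :=
  forall z y t, 0 <= t <= 1 -> forall eps, 0 < eps -> exists delta, 0 < delta /\
    forall z' y' t', close m z z' delta -> close n y y' delta -> 0 <= t' <= 1 ->
      Rabs (t - t') < delta -> dist (h z y t) (h z' y' t') < eps.

Definition eps_homotopic (M : MetricSpace) (m n : nat) (eps : R)
  (g g' : cube m -> cube n -> M) : Prop :=
  exists h : cube m -> cube n -> R -> M,
    cont_homotopy M m n h /\
    (forall z y, h z y 0 = g z y) /\ (forall z y, h z y 1 = g' z y) /\
    (forall z y, exists r, r < eps /\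
       forall t t', 0 <= t <= 1 -> 0 <= t' <= 1 -> dist (h z y t) (h z y t') <= r).

Definition FAP (n : nat) (M : MetricSpace) : Prop :=
  forall eps, 0 < eps -> forall (m : nat) (g : cube m -> cube n -> M),
    cont_map M m n g ->
    exists g' : cube m -> cube n -> M,
      cont_map M m n g' /\ eps_homotopic M m n eps g g' /\
      forall z : cube m, dim_le M (fun p => exists y, g' z y = p) n.

(* Main.v *)
From Stdlib Require Import Reals Arith Lra Lia List ProofIrrelevance.
From Stdlib Require Import ClassicalEpsilon FunctionalExtensionality PropExtensionality.
From Coquelicot Require Compactness.
Require Import Defs.
Open Scope R_scope.

(** For maps of a compact cube, the condition that every fiber image has a small
    open cover of order at most [n + 1] is an open one. Given [g], cover the cube
    by finitely many boxes, each mapped into a neighborhood with [FAP n], robustly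
    under small perturbations of [g]. Over each box the condition can be achieved
    by an arbitrarily small homotopy: run the local homotopy on a larger box and
    damp it near the boundary. Completeness of [M] lets one concatenate infinitely
    many such homotopies, treating every box at every scale, as in Baire's theorem.
    In the limit each fiber image is a finite union of compact sets of dimension at
    most [n], hence has dimension at most [n] by the sum theorem. *)

(** * Metric spaces and continuous maps *)

(** Two obstacles shape the argument. The bound [dim <= n] itself is destroyed by arbitrarily small
    changes of a map, and neighbouring boxes overlap, so work on one box may spoil another. This is
    why the bound is split into countably many conditions, one for each mesh, each with a margin
    that later changes can be kept within. Moreover [M] has no extension property: a new map on a
    box extends to the whole cube only because it is joined to the old one by a homotopy, whose
    running time can decrease to zero towards the boundary. In the collar where the homotopy stops
    early nothing is known about dimension, so every box comes with a concentric one of twice the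
    radius. The boxes are products: for fixed [z] a single box in the first factor contains [z], and
    finitely many boxes in the second factor exhaust the fiber over [z]. *)

Definition RM : MetricSpace.
Proof.
  refine {| pt := R; dist := fun x y => Rabs (x - y) |}.
  - intros; apply Rabs_pos.
  - intros; apply Rabs_minus_sym.
  - intros x; rewrite Rminus_diag; apply Rabs_R0.
  - intros x y H. destruct (Req_dec (x - y) 0) as [E|E]; [lra|].
    now apply Rabs_no_R0 in E.
  - intros x y z. replace (x - z) with ((x - y) + (y - z)) by ring.
    apply Rabs_triang.
Defined.

Definition prodM (X Y : MetricSpace) : MetricSpace.
Proof.
  refine {| pt := (X * Y)%type;
            dist := fun p q => Rmax (dist (fst p) (fst q)) (dist (snd p) (snd q)) |}.
  - intros p q. apply Rle_trans with (dist (fst p) (fst q)).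
    + apply dist_nonneg.
    + apply Rmax_l.
  - intros p q. now rewrite (dist_sym X), (dist_sym Y).
  - intros p. rewrite !dist_refl. apply Rmax_left; lra.
  - intros [x y] [x' y']; simpl; intros H.
    pose proof (Rmax_l (dist x x') (dist y y')).
    pose proof (Rmax_r (dist x x') (dist y y')).
    pose proof (dist_nonneg X x x'). pose proof (dist_nonneg Y y y').
    f_equal; apply dist_eq; lra.
  - intros [x y] [x' y'] [x'' y'']; simpl.
    pose proof (Rmax_l (dist x x') (dist y y')).
    pose proof (Rmax_r (dist x x') (dist y y')).
    pose proof (Rmax_l (dist x' x'') (dist y' y'')).
    pose proof (Rmax_r (dist x' x'') (dist y' y'')).
    pose proof (dist_tri X x x' x''). pose proof (dist_tri Y y y' y'').
    apply Rmax_lub; lra.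
Defined.

Lemma prod_dist_lt (X Y : MetricSpace) (p q : prodM X Y) d :
  dist p q < d <-> dist (fst p) (fst q) < d /\ dist (snd p) (snd q) < d.
Proof. apply Rmax_Rlt. Qed.

Lemma prod_dist_le (X Y : MetricSpace) (p q : prodM X Y) d :
  dist p q <= d <-> dist (fst p) (fst q) <= d /\ dist (snd p) (snd q) <= d.
Proof.
  simpl. split.
  - intros H.
    pose proof (Rmax_l (dist (fst p) (fst q)) (dist (snd p) (snd q))).
    pose proof (Rmax_r (dist (fst p) (fst q)) (dist (snd p) (snd q))).
    lra.
  - intros [H H']. now apply Rmax_lub.
Qed.

Definition cont {X Y : MetricSpace} (f : X -> Y) : Prop :=
  forall x eps, 0 < eps -> exists delta, 0 < delta /\
    forall x', dist x x' < delta -> dist (f x) (f x') < eps.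

Lemma cont_lipschitz (X Y : MetricSpace) (f : X -> Y) (L : R) :
  0 < L -> (forall x x', dist (f x) (f x') <= L * dist x x') -> cont f.
Proof.
  intros HL H x eps He. exists (eps / L). split.
  - now apply Rdiv_lt_0_compat.
  - intros x' Hx. apply Rle_lt_trans with (1 := H x x').
    apply Rmult_lt_compat_l with (r := L) in Hx; auto.
    replace (L * (eps / L)) with eps in Hx by (field; lra). lra.
Qed.

Lemma cont_comp (X Y Z : MetricSpace) (f : X -> Y) (g : Y -> Z) :
  cont f -> cont g -> cont (fun x => g (f x)).
Proof.
  intros Hf Hg x eps He.
  destruct (Hg (f x) eps He) as [d [Hd Hgd]].
  destruct (Hf x d Hd) as [d' [Hd' Hfd]].
  exists d'; split; auto.
Qed.

Lemma cont_pair (X Y Z : MetricSpace) (f : X -> Y) (g : X -> Z) :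
  cont f -> cont g -> cont (Y := prodM Y Z) (fun x => (f x, g x)).
Proof.
  intros Hf Hg x eps He.
  destruct (Hf x eps He) as [d [Hd Hfd]].
  destruct (Hg x eps He) as [d' [Hd' Hgd]].
  exists (Rmin d d'); split; [now apply Rmin_pos|].
  intros x' Hx. apply prod_dist_lt; simpl.
  pose proof (Rmin_l d d'). pose proof (Rmin_r d d').
  split; [apply Hfd|apply Hgd]; lra.
Qed.

Lemma cont_fst (X Y : MetricSpace) : cont (X := prodM X Y) (Y := X) fst.
Proof.
  intros x eps He. exists eps; split; auto.
  intros x' Hx. now apply prod_dist_lt in Hx.
Qed.

Lemma cont_snd (X Y : MetricSpace) : cont (X := prodM X Y) (Y := Y) snd.
Proof.
  intros x eps He. exists eps; split; auto.
  intros x' Hx. now apply prod_dist_lt in Hx.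
Qed.

Lemma cont_id (X : MetricSpace) : cont (fun x : X => x).
Proof. intros x eps He. now exists eps. Qed.

Lemma cont_const (X Y : MetricSpace) (y : Y) : cont (fun _ : X => y).
Proof.
  intros x eps He. exists 1; split; [lra|].
  intros. now rewrite dist_refl.
Qed.

Lemma cont_dist (X : MetricSpace) (a : X) : cont (Y := RM) (fun x => dist a x).
Proof.
  apply cont_lipschitz with (L := 1); [lra|]. intros x x'; simpl.
  pose proof (dist_tri X a x x'). pose proof (dist_tri X a x' x).
  rewrite (dist_sym X x' x) in *. apply Rabs_le; lra.
Qed.

(** Pasting along the closed sets [d <= 0] and [d >= 0]. Both maps are taken continuous on all of
    [X], which avoids subspaces; in the applications clamped formulas make them total. *)
Lemma cont_paste (X Y : MetricSpace) (d : X -> RM) (f g : X -> Y) :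
  cont d -> cont f -> cont g -> (forall x, d x = 0 -> f x = g x) ->
  cont (fun x => if Rle_dec (d x) 0 then f x else g x).
Proof.
  intros Hd Hf Hg Hfg x eps He.
  destruct (Hf x eps He) as [df [Hdf Cf]].
  destruct (Hg x eps He) as [dg [Hdg Cg]].
  destruct (Req_dec (d x) 0) as [E|E].
  - exists (Rmin df dg); split; [now apply Rmin_pos|].
    intros x' Hx. pose proof (Rmin_l df dg). pose proof (Rmin_r df dg).
    destruct (Rle_dec (d x) 0); [|lra].
    destruct (Rle_dec (d x') 0).
    + apply Cf; lra.
    + rewrite Hfg by assumption. apply Cg; lra.
  - destruct (Hd x (Rabs (d x))) as [dd [Hdd Cd]]; [now apply Rabs_pos_lt|].
    exists (Rmin dd (Rmin df dg)); split; [now repeat apply Rmin_pos|].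
    intros x' Hx. pose proof (Rmin_l df dg). pose proof (Rmin_r df dg).
    pose proof (Rmin_l dd (Rmin df dg)). pose proof (Rmin_r dd (Rmin df dg)).
    assert (Hx' : dist x x' < dd) by lra.
    apply Cd in Hx'. simpl in Hx'.
    destruct (Rle_dec (d x) 0), (Rle_dec (d x') 0).
    + apply Cf; lra.
    + revert Hx'. unfold Rabs; repeat destruct Rcase_abs; lra.
    + revert Hx'. unfold Rabs; repeat destruct Rcase_abs; lra.
    + apply Cg; lra.
Qed.

Lemma halving_small (e : nat -> R) :
  (forall k, 0 < e k) -> (forall k, e (S k) <= e k / 2) ->
  forall eps, 0 < eps -> exists k, e k < eps.
Proof.
  intros He Hh eps Hp.
  assert (Hpow : forall k, e k <= e 0%nat * (/ 2) ^ k).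
  { induction k as [|k IH]; simpl; [lra|]. pose proof (Hh k). lra. }
  destruct (pow_lt_1_zero (/ 2)) with (y := eps / e 0%nat) as [N HN].
  - rewrite Rabs_right; lra.
  - now apply Rdiv_lt_0_compat.
  - exists N. specialize (HN N (le_n N)).
    rewrite Rabs_right in HN by (apply Rle_ge, pow_le; lra).
    apply Rle_lt_trans with (1 := Hpow N).
    apply Rmult_lt_compat_l with (r := e 0%nat) in HN; auto.
    replace (e 0%nat * (eps / e 0%nat)) with eps in HN; auto.
    field. apply Rgt_not_eq, He.
Qed.

Lemma uniform_limit (X M : MetricSpace) (F : nat -> X -> M) (e : nat -> R) :
  complete M -> (forall k, 0 < e k) -> (forall k, e (S k) <= e k / 2) ->
  (forall k, cont (F k)) -> (forall k x, dist (F k x) (F (S k) x) <= e k / 2) ->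
  exists G, cont G /\ forall k x, dist (F k x) (G x) <= e k.
Proof.
  intros HM He Hh Hc Hd.
  (* Since [e (S k) <= e k / 2], the step [e k / 2] is at most [e k - e (S k)], and the sum
     telescopes. *)
  assert (Htel : forall j k x, dist (F k x) (F (k + j)%nat x) <= e k - e (k + j)%nat).
  { induction j as [|j IH]; intros k x.
    - rewrite Nat.add_0_r, dist_refl; lra.
    - rewrite Nat.add_succ_r.
      pose proof (IH k x). pose proof (Hd (k + j)%nat x). pose proof (Hh (k + j)%nat).
      pose proof (dist_tri M (F k x) (F (k + j)%nat x) (F (S (k + j)) x)). lra. }
  pose proof (halving_small e He Hh) as Hsmall.
  assert (Hlim : forall x, exists l, converges_to M (fun k => F k x) l).
  { intros x. apply HM. intros eps Hp. destruct (Hsmall (eps / 2)) as [N HN]; [lra|].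
    exists N. intros p q Hp' Hq.
    pose proof (Htel (p - N)%nat N x) as H1. pose proof (Htel (q - N)%nat N x) as H2.
    replace (N + (p - N))%nat with p in H1 by lia.
    replace (N + (q - N))%nat with q in H2 by lia.
    pose proof (dist_tri M (F p x) (F N x) (F q x)).
    rewrite (dist_sym M (F p x) (F N x)) in *.
    pose proof (He p); pose proof (He q). lra. }
  pose (G := fun x => proj1_sig (constructive_indefinite_description _ (Hlim x))).
  assert (HG : forall x, converges_to M (fun k => F k x) (G x))
    by (intros x; exact (proj2_sig (constructive_indefinite_description _ (Hlim x)))).
  assert (Hbd : forall k x, dist (F k x) (G x) <= e k).
  { intros k x. apply Rnot_lt_le. intros Hlt.
    destruct (HG x (dist (F k x) (G x) - e k)) as [N HN]; [lra|].
    pose proof (HN (k + N)%nat ltac:(lia)). pose proof (Htel N k x).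
    pose proof (dist_tri M (F k x) (F (k + N)%nat x) (G x)).
    pose proof (He (k + N)%nat). lra. }
  exists G; split; auto.
  intros x eps Hp. destruct (Hsmall (eps / 3)) as [k Hk]; [lra|].
  destruct (Hc k x (eps / 3)) as [d [Hd0 Hcd]]; [lra|].
  exists d; split; auto. intros x' Hx.
  pose proof (Hcd x' Hx). pose proof (Hbd k x). pose proof (Hbd k x').
  pose proof (dist_tri M (G x) (F k x) (G x')).
  pose proof (dist_tri M (F k x) (F k x') (G x')).
  rewrite (dist_sym M (G x) (F k x)) in *. lra.
Qed.

(** The retraction of the line onto the unit interval. It lets homotopies be maps on [prodM X RM],
    with all reals as times. *)
Definition clamp (t : R) : R := Rmax 0 (Rmin 1 t).

Lemma clamp_range t : 0 <= clamp t <= 1.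
Proof. unfold clamp, Rmax, Rmin; repeat destruct Rle_dec; lra. Qed.

Lemma clamp_id t : 0 <= t <= 1 -> clamp t = t.
Proof. intros. unfold clamp, Rmax, Rmin; repeat destruct Rle_dec; lra. Qed.

Lemma clamp_0 t : t <= 0 -> clamp t = 0.
Proof. intros. unfold clamp, Rmax, Rmin; repeat destruct Rle_dec; lra. Qed.

Lemma clamp_1 t : 1 <= t -> clamp t = 1.
Proof. intros. unfold clamp, Rmax, Rmin; repeat destruct Rle_dec; lra. Qed.

Lemma clamp_lipschitz s t : Rabs (clamp s - clamp t) <= Rabs (s - t).
Proof.
  unfold clamp, Rmax, Rmin; repeat destruct Rle_dec;
    unfold Rabs; repeat destruct Rcase_abs; lra.
Qed.

Lemma cont_clamp : cont (X := RM) (Y := RM) clamp.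
Proof.
  apply cont_lipschitz with (L := 1); [lra|].
  intros; simpl. rewrite Rmult_1_l. apply clamp_lipschitz.
Qed.

Lemma cont_affine (u v : R) : cont (X := RM) (Y := RM) (fun t => u * t + v).
Proof.
  apply cont_lipschitz with (L := Rabs u + 1).
  - pose proof (Rabs_pos u); lra.
  - intros x x'; simpl. replace (u * x + v - (u * x' + v)) with (u * (x - x')) by ring.
    rewrite Rabs_mult. apply Rmult_le_compat_r; [apply Rabs_pos|lra].
Qed.

Lemma cont_mult (X : MetricSpace) (f g : X -> RM) :
  cont f -> cont g -> (forall x, Rabs (f x) <= 1) -> (forall x, Rabs (g x) <= 1) ->
  cont (Y := RM) (fun x => f x * g x).
Proof.
  intros Hf Hg Bf Bg x eps He.
  destruct (Hf x (eps / 2)) as [df [Hdf Cf]]; [lra|].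
  destruct (Hg x (eps / 2)) as [dg [Hdg Cg]]; [lra|].
  exists (Rmin df dg); split; [now apply Rmin_pos|].
  intros x' Hx. pose proof (Rmin_l df dg). pose proof (Rmin_r df dg).
  assert (H1 : dist (f x) (f x') < eps / 2) by (apply Cf; lra).
  assert (H2 : dist (g x) (g x') < eps / 2) by (apply Cg; lra).
  simpl in *.
  replace (f x * g x - f x' * g x') with
    ((f x - f x') * g x + f x' * (g x - g x')) by ring.
  apply Rle_lt_trans with (1 := Rabs_triang _ _). rewrite !Rabs_mult.
  pose proof (Bf x'). pose proof (Bg x).
  pose proof (Rabs_pos (f x - f x')). pose proof (Rabs_pos (g x - g x')). nra.
Qed.

(** * Compactness of cubes *)

(** Compactness in gauge form: a radius is prescribed at each point, and finitely many of the
    resulting balls cover. *)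
Definition compact (X : MetricSpace) : Prop :=
  forall delta : X -> R, (forall x, 0 < delta x) ->
    exists l : list X, forall x, exists t, In t l /\ dist t x < delta t.

(** An abstract Lebesgue number principle. Unlike the gauge form, it passes to products by plain
    currying. *)
Definition locally_uniform_is_uniform (X : MetricSpace) : Prop :=
  forall Q : X -> R -> Prop,
    (forall x d d', d' <= d -> Q x d -> Q x d') ->
    (forall x, exists d, 0 < d /\ forall x', dist x x' < d -> Q x' d) ->
    exists d, 0 < d /\ forall x, Q x d.

Lemma compact_uniform (X : MetricSpace) :
  compact X -> locally_uniform_is_uniform X.
Proof.
  intros HX Q Qmono Qloc.
  pose (delta := fun x => proj1_sig (constructive_indefinite_description _ (Qloc x))).
  assert (Hdelta : forall x, 0 < delta x /\ forall x', dist x x' < delta x -> Q x' (delta x))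
    by (intros x; exact (proj2_sig (constructive_indefinite_description _ (Qloc x)))).
  destruct (HX delta) as [l Hl]; [intros; apply Hdelta|].
  assert (Hmin : exists d, 0 < d /\ forall t, In t l -> d <= delta t).
  { clear Hl. induction l as [|a l [d [Hd IH]]].
    - exists 1; split; [lra|]. intros t [].
    - exists (Rmin (delta a) d); split.
      + apply Rmin_pos; auto. apply Hdelta.
      + intros t [<-|Ht]; [apply Rmin_l|].
        apply Rle_trans with d; [apply Rmin_r|auto]. }
  destruct Hmin as [d [Hd Hmin]].
  exists d; split; auto. intros x. destruct (Hl x) as [t [Ht Hx]].
  apply Qmono with (delta t); auto. now apply Hdelta.
Qed.

(** The tube lemma: at fixed [x] the principle for [Y] is applied to a predicate that already
    quantifies over the points near [x], which yields a tube around the fiber. *)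
Lemma uniform_prod (X Y : MetricSpace) :
  locally_uniform_is_uniform X -> locally_uniform_is_uniform Y ->
  locally_uniform_is_uniform (prodM X Y).
Proof.
  intros HX HY Q Qmono Qloc.
  destruct (HX (fun x d => forall y, Q (x, y) d)) as [d [Hd H]].
  - intros x d d' Hle H y. apply Qmono with d; auto.
  - intros x.
    destruct (HY (fun y d => forall x', dist x x' < d -> Q (x', y) d)) as [d [Hd H]].
    + intros y d d' Hle H x' Hx. apply Qmono with d; auto. apply H; lra.
    + intros y. destruct (Qloc (x, y)) as [d [Hd H]].
      exists d; split; auto. intros y' Hy x' Hx. apply H. now apply prod_dist_lt.
    + exists d; split; auto.
  - exists d; split; auto. intros [x y]; apply H.
Qed.

Fixpoint rmax (k : nat) (f : nat -> R) : R :=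
  match k with O => 0 | S k => Rmax (rmax k f) (f k) end.

Lemma rmax_nonneg k f : 0 <= rmax k f.
Proof.
  induction k; simpl; [lra|]. apply Rle_trans with (1 := IHk), Rmax_l.
Qed.

Lemma rmax_ge k f i : (i < k)%nat -> f i <= rmax k f.
Proof.
  induction k; simpl; intros H; [lia|].
  destruct (Nat.eq_dec i k) as [->|E]; [apply Rmax_r|].
  apply Rle_trans with (rmax k f); [apply IHk; lia|apply Rmax_l].
Qed.

Lemma rmax_le k f d : 0 <= d -> (forall i, (i < k)%nat -> f i <= d) -> rmax k f <= d.
Proof.
  intros Hd. induction k; simpl; intros H; auto.
  apply Rmax_lub; [apply IHk|]; auto.
Qed.

Lemma rmax_lt k f d : 0 < d -> (forall i, (i < k)%nat -> f i < d) -> rmax k f < d.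
Proof.
  intros Hd. induction k; simpl; intros H; auto.
  apply Rmax_lub_lt; [apply IHk|]; auto.
Qed.

Lemma cube_ext k (x y : cube k) :
  (forall i, (i < k)%nat -> proj1_sig x i = proj1_sig y i) -> x = y.
Proof.
  destruct x as [x Hx], y as [y Hy]; simpl; intros H.
  assert (E : x = y).
  { apply functional_extensionality. intros i.
    destruct (Nat.lt_ge_cases i k) as [L|L]; auto.
    now rewrite (proj2 (Hx i) L), (proj2 (Hy i) L). }
  subst y. f_equal. apply proof_irrelevance.
Qed.

(** The maximum metric, because its balls of positive radius are exactly the relation [close] used
    for continuity in the statement. *)
Definition cubeM (k : nat) : MetricSpace.
Proof.
  refine {| pt := cube k;
            dist := fun x y => rmax k (fun i => Rabs (proj1_sig x i - proj1_sig y i)) |}.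
  - intros; apply rmax_nonneg.
  - intros x y. f_equal. apply functional_extensionality. intros; apply Rabs_minus_sym.
  - intros x. apply Rle_antisym; [|apply rmax_nonneg].
    apply rmax_le; [lra|]. intros. rewrite Rminus_diag, Rabs_R0; lra.
  - intros x y H. apply cube_ext. intros i Hi.
    pose proof (rmax_ge k (fun i => Rabs (proj1_sig x i - proj1_sig y i)) i Hi) as Hm.
    cbv beta in Hm. rewrite H in Hm. apply (dist_eq RM).
    apply Rle_antisym; [exact Hm|apply dist_nonneg].
  - intros x y z. apply rmax_le.
    + apply Rplus_le_le_0_compat; apply rmax_nonneg.
    + intros i Hi.
      pose proof (rmax_ge k (fun i => Rabs (proj1_sig x i - proj1_sig y i)) i Hi).
      pose proof (rmax_ge k (fun i => Rabs (proj1_sig y i - proj1_sig z i)) i Hi).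
      pose proof (dist_tri RM (proj1_sig x i) (proj1_sig y i) (proj1_sig z i)).
      simpl in *. lra.
Defined.

Lemma close_dist k (x y : cubeM k) d : 0 < d -> close k x y d <-> dist x y < d.
Proof.
  intros Hd; split.
  - intros H. now apply rmax_lt.
  - intros H i Hi. apply Rle_lt_trans with (2 := H).
    exact (rmax_ge k (fun i => Rabs (proj1_sig x i - proj1_sig y i)) i Hi).
Qed.

Definition mkcube (k : nat) (f : nat -> R) : cubeM k.
Proof.
  exists (fun i => if lt_dec i k then clamp (f i) else 0).
  intros i. destruct (lt_dec i k); split; try lia; try lra. apply clamp_range.
Defined.

Lemma mkcube_coord k f i : (i < k)%nat -> proj1_sig (mkcube k f) i = clamp (f i).
Proof. simpl. intros; now destruct (lt_dec i k). Qed.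

Lemma mkcube_dist k f f' c :
  0 <= c -> (forall i, (i < k)%nat -> Rabs (f i - f' i) <= c) ->
  dist (mkcube k f) (mkcube k f') <= c.
Proof.
  intros Hc H. apply rmax_le; auto. intros i Hi.
  rewrite !mkcube_coord by assumption.
  apply Rle_trans with (1 := clamp_lipschitz _ _); auto.
Qed.

Lemma coord_dist k (x y : cubeM k) i :
  (i < k)%nat -> Rabs (proj1_sig x i - proj1_sig y i) <= dist x y.
Proof. exact (rmax_ge k (fun i => Rabs (proj1_sig x i - proj1_sig y i)) i). Qed.

Fixpoint to_tuple (k : nat) (f : nat -> R) : Compactness.Tn k R :=
  match k with
  | O => tt
  | S k => (f O, to_tuple k (fun i => f (S i)))
  end.

Fixpoint of_tuple (k : nat) : Compactness.Tn k R -> nat -> R :=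
  match k with
  | O => fun _ _ => 0
  | S k => fun t i => match i with O => fst t | S i => of_tuple k (snd t) i end
  end.

Lemma to_tuple_bounded k f :
  (forall i, 0 <= f i <= 1) ->
  Compactness.bounded_n k (to_tuple k (fun _ => 0)) (to_tuple k (fun _ => 1)) (to_tuple k f).
Proof.
  revert f; induction k; simpl; auto.
Qed.

Lemma of_tuple_bounded k t :
  Compactness.bounded_n k (to_tuple k (fun _ => 0)) (to_tuple k (fun _ => 1)) t ->
  forall i, 0 <= of_tuple k t i <= 1.
Proof.
  revert t; induction k; simpl.
  - intros; lra.
  - intros [x t] [H H'] [|i]; simpl; auto.
Qed.

Lemma close_tuple k f t d :
  Compactness.close_n k d (to_tuple k f) t ->
  forall i, (i < k)%nat -> Rabs (f i - of_tuple k t i) < d.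
Proof.
  revert f t; induction k; simpl; [intros; lia|].
  intros f [x t] [H H'] [|i] Hi; simpl; auto.
  apply (IHk (fun i => f (S i))); auto. lia.
Qed.

Lemma cube_compact k : compact (cubeM k).
Proof.
  (* The compactness theorem for tuples of reals is stated under a double negation. *)
  intros delta Hdelta. apply NNPP. intros Hn.
  apply (Compactness.compactness_list k (to_tuple k (fun _ => 0)) (to_tuple k (fun _ => 1))
           (fun t => mkposreal _ (Hdelta (mkcube k (of_tuple k t))))).
  intros [l Hl]. apply Hn.
  exists (map (fun t => mkcube k (of_tuple k t)) l). intros x.
  destruct (Hl (to_tuple k (proj1_sig x))) as [t [Ht [Hb Hc]]].
  - apply to_tuple_bounded. intros i. apply (proj2_sig x).
  - exists (mkcube k (of_tuple k t)). split.
    + now apply (in_map (fun t => mkcube k (of_tuple k t))).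
    + rewrite (dist_sym (cubeM k)). apply close_dist; [apply Hdelta|].
      intros i Hi. rewrite mkcube_coord, clamp_id; auto.
      * exact (close_tuple _ _ _ _ Hc i Hi).
      * now apply of_tuple_bounded.
Qed.

(** * Covering dimension *)

Definition order_at (M : MetricSpace) (l : nat) (V : nat -> M -> Prop) (x : M) (N : nat) : Prop :=
  forall idx, NoDup idx -> (forall i, In i idx -> (i < l)%nat /\ V i x) -> (length idx <= N)%nat.

(* [dim_le] with the finite families indexed by an initial segment of [nat]. *)
Definition dim_fam (M : MetricSpace) (A : M -> Prop) (n : nat) : Prop :=
  forall (k : nat) (U : nat -> M -> Prop),
    (forall i, (i < k)%nat -> rel_open M A (U i)) ->
    (forall x, A x -> exists i, (i < k)%nat /\ U i x) ->
    exists (l : nat) (V : nat -> M -> Prop) (f : nat -> nat),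
      (forall i, (i < l)%nat -> rel_open M A (V i)) /\
      (forall x, A x -> exists i, (i < l)%nat /\ V i x) /\
      (forall i, (i < l)%nat -> (f i < k)%nat /\ forall x, A x -> V i x -> U (f i) x) /\
      (forall x, A x -> order_at M l V x (S n)).

Lemma nth_map_seq (T : Type) (F : nat -> T) l i d :
  (i < l)%nat -> nth i (map F (seq 0 l)) d = F i.
Proof.
  intros H. rewrite nth_indep with (d' := F O) by now rewrite length_map, length_seq.
  rewrite map_nth, seq_nth; auto.
Qed.

Lemma dim_le_fam (M : MetricSpace) (A : M -> Prop) n : dim_le M A n -> dim_fam M A n.
Proof.
  intros H k U HU Hc.
  destruct (H (map U (seq 0 k))) as [Vs [HV [HVc [HVr HVo]]]].
  - intros W HW. apply in_map_iff in HW. destruct HW as [i [<- Hi]].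
    apply in_seq in Hi. apply HU; lia.
  - intros x Hx. destruct (Hc x Hx) as [i [Hi Hu]]. exists (U i); split; auto.
    apply in_map, in_seq; lia.
  - pose (V := fun i => nth i Vs (fun _ => False)).
    assert (Hf : forall i, exists j, (i < length Vs)%nat ->
              (j < k)%nat /\ forall x, A x -> V i x -> U j x).
    { intros i. destruct (lt_dec i (length Vs)) as [L|L]; [|exists O; lia].
      destruct (HVr (V i)) as [W [HW HWr]]; [now apply nth_In|].
      apply in_map_iff in HW. destruct HW as [j [<- Hj]]. apply in_seq in Hj.
      exists j; intros _; split; auto; lia. }
    exists (length Vs), V,
      (fun i => proj1_sig (constructive_indefinite_description _ (Hf i))).
    repeat split.
    + intros i Hi. apply HV. now apply nth_In.
    + intros x Hx. destruct (HVc x Hx) as [W [HW HWx]].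
      destruct (In_nth Vs W (fun _ => False) HW) as [i [Hi E]].
      exists i; split; auto. unfold V. now rewrite E.
    + destruct (constructive_indefinite_description _ (Hf i)) as [j Hj]; simpl.
      now apply Hj.
    + destruct (constructive_indefinite_description _ (Hf i)) as [j Hj]; simpl.
      now apply Hj.
    + intros x Hx idx Hnd Hi. now apply (HVo x Hx).
Qed.

Lemma dim_fam_le (M : MetricSpace) (A : M -> Prop) n : dim_fam M A n -> dim_le M A n.
Proof.
  intros H Us HU Hc.
  destruct (H (length Us) (fun i => nth i Us (fun _ => False)))
    as [l [V [f [HV [HVc [HVr HVo]]]]]].
  - intros i Hi. apply HU. now apply nth_In.
  - intros x Hx. destruct (Hc x Hx) as [W [HW HWx]].
    destruct (In_nth Us W (fun _ => False) HW) as [i [Hi E]].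
    exists i; split; auto. now rewrite E.
  - exists (map V (seq 0 l)). repeat split.
    + intros W HW. apply in_map_iff in HW. destruct HW as [i [<- Hi]].
      apply in_seq in Hi. apply HV; lia.
    + intros x Hx. destruct (HVc x Hx) as [i [Hi Hu]]. exists (V i); split; auto.
      apply in_map, in_seq; lia.
    + intros W HW. apply in_map_iff in HW. destruct HW as [i [<- Hi]].
      apply in_seq in Hi. destruct (HVr i) as [Hfi Hsub]; [lia|].
      exists (nth (f i) Us (fun _ => False)); split; auto. now apply nth_In.
    + intros x Hx idx Hnd Hi. apply (HVo x Hx idx Hnd). intros i Hin.
      destruct (Hi i Hin) as [Hl HVx]. rewrite length_map, length_seq in Hl.
      split; auto. now rewrite nth_map_seq in HVx.
Qed.

(** Dimension is intrinsic. [FAP] of a subspace bounds dimension inside that subspace, whereas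
    covers are later compared inside [M]. *)
Lemma dim_le_isometry (N M : MetricSpace) (iota : N -> M) (A : N -> Prop) n :
  (forall x y, dist (iota x) (iota y) = dist x y) ->
  dim_le N A n -> dim_le M (fun p => exists x, A x /\ iota x = p) n.
Proof.
  intros Hiso H. apply dim_fam_le. apply dim_le_fam in H. intros k U HU Hc.
  assert (Hinj : forall x y, iota x = iota y -> x = y).
  { intros x y E. apply dist_eq. now rewrite <- Hiso, E, dist_refl. }
  destruct (H k (fun i x => U i (iota x))) as [l [V [f [HV [HVc [HVr HVo]]]]]].
  - intros i Hi x Hx Hu.
    destruct (HU i Hi (iota x)) as [r [Hr Hb]]; eauto.
    exists r; split; auto. intros y Hy Hd. apply Hb; eauto. now rewrite Hiso.
  - intros x Hx. apply Hc; eauto.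
  - exists l, (fun i p => exists x, V i x /\ iota x = p), f. repeat split.
    + intros i Hi p [x [Hx <-]] [x' [Hv Ex]]. apply Hinj in Ex; subst x'.
      destruct (HV i Hi x Hx Hv) as [r [Hr Hb]]. exists r; split; auto.
      intros q [y [Hy <-]] Hd. exists y; split; auto. apply Hb; auto.
      now rewrite <- Hiso.
    + intros p [x [Hx <-]]. destruct (HVc x Hx) as [i [Hi Hv]]. exists i; eauto.
    + now apply HVr.
    + intros p [x [Hx <-]] [x' [Hv Ex]]. apply Hinj in Ex; subst x'.
      now apply HVr.
    + intros p [x [Hx <-]] idx Hnd Hi. apply (HVo x Hx idx Hnd). intros i Hin.
      destruct (Hi i Hin) as [Hl [x' [Hv Ex]]]. apply Hinj in Ex; now subst x'.
Qed.

(** * Extension of relatively open sets and the finite closed sum theorem *)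

Definition is_open (M : MetricSpace) (U : M -> Prop) : Prop :=
  forall x, U x -> exists r, 0 < r /\ forall y, dist x y < r -> U y.

Definition is_closed (M : MetricSpace) (A : M -> Prop) : Prop :=
  is_open M (fun x => ~ A x).

Lemma is_open_and (M : MetricSpace) (U V : M -> Prop) :
  is_open M U -> is_open M V -> is_open M (fun x => U x /\ V x).
Proof.
  intros HU HV x [Hx Hx'].
  destruct (HU x Hx) as [r [Hr H]]. destruct (HV x Hx') as [r' [Hr' H']].
  exists (Rmin r r'); split; [now apply Rmin_pos|]. intros y Hy.
  pose proof (Rmin_l r r'). pose proof (Rmin_r r r').
  split; [apply H|apply H']; lra.
Qed.

Lemma is_open_ball (M : MetricSpace) (c : M) d : is_open M (fun x => dist c x < d).
Proof.
  intros x Hx. exists (d - dist c x); split; [lra|]. intros y Hy.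
  pose proof (dist_tri M c x y). lra.
Qed.

(* An operator extending relatively open subsets of [A] to open subsets of [M]
   which creates no new intersections, so that orders of families are preserved. *)
Definition open_ext (M : MetricSpace) (A V : M -> Prop) (x : M) : Prop :=
  exists r a, A a /\ dist x a < r /\ forall a', A a' -> dist x a' < r -> V a'.

Lemma open_ext_open (M : MetricSpace) (A V : M -> Prop) : is_open M (open_ext M A V).
Proof.
  intros x [r [a [Ha [Hr H]]]].
  exists ((r - dist x a) / 2); split; [lra|]. intros y Hy.
  exists (r - (r - dist x a) / 2), a; split; auto.
  pose proof (dist_tri M y x a). rewrite (dist_sym M y x) in *. split; [lra|].
  intros a' Ha' Hd. apply H; auto. pose proof (dist_tri M x y a'). lra.
Qed.

Lemma open_ext_incl (M : MetricSpace) (A V : M -> Prop) x :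
  rel_open M A V -> A x -> V x -> open_ext M A V x.
Proof.
  intros HV Hx Hv. destruct (HV x Hx Hv) as [r [Hr H]].
  exists r, x. now rewrite dist_refl.
Qed.

(** The witnessing balls all have centre [x], hence are nested; a point of [A] in the smallest one
    lies in every [V i]. This is why extension does not raise the order. *)
Lemma open_ext_common (M : MetricSpace) (A : M -> Prop) (V : nat -> M -> Prop) x idx :
  idx <> nil -> (forall i, In i idx -> open_ext M A (V i) x) ->
  exists a, A a /\ forall i, In i idx -> V i a.
Proof.
  intros Hne H.
  enough (exists r a, A a /\ dist x a < r /\
            forall i, In i idx -> forall a', A a' -> dist x a' < r -> V i a')
    as [r [a [Ha [Hr Hi]]]] by (exists a; auto).
  induction idx as [|i idx IH]; [easy|].
  destruct (H i (or_introl eq_refl)) as [r [a [Ha [Hr Hi]]]].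
  destruct idx as [|j idx'].
  - exists r, a. repeat split; auto. intros i' [<-|[]]; auto.
  - destruct IH as [r' [a' [Ha' [Hr' Hi']]]]; [easy|intros; apply H; now right|].
    destruct (Rle_dec r r').
    + exists r, a. repeat split; auto. intros i' [<-|Hin] b Hb Hd; auto.
      apply Hi'; auto; lra.
    + exists r', a'. repeat split; auto. intros i' [<-|Hin] b Hb Hd; auto.
      apply Hi; auto; lra.
Qed.

Lemma open_ext_order (M : MetricSpace) (A : M -> Prop) l (V : nat -> M -> Prop) N :
  (forall a, A a -> order_at M l V a N) ->
  forall x, order_at M l (fun i => open_ext M A (V i)) x N.
Proof.
  intros H x idx Hnd Hi.
  destruct idx as [|j idx]; [simpl; lia|].
  destruct (open_ext_common M A V x (j :: idx)) as [a [Ha Hv]]; [easy|apply Hi|].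
  apply (H a Ha); auto. intros i Hin. split; auto. now apply Hi.
Qed.

(** For families merged along [f]: distinct merged sets at a point come from distinct original sets,
    so merging does not raise the order. *)
Lemma NoDup_choose_preimages (f : nat -> nat) (P : nat -> Prop) idx :
  NoDup idx -> (forall j, In j idx -> exists i, f i = j /\ P i) ->
  exists idx', NoDup idx' /\ length idx' = length idx /\
    forall i, In i idx' -> In (f i) idx /\ P i.
Proof.
  induction 1 as [|j idx Hj Hnd IH]; intros H.
  - exists nil. repeat split; auto using NoDup_nil; simpl in *; tauto.
  - destruct IH as [idx' [Hnd' [Hlen Hin]]]; [intros; apply H; now right|].
    destruct (H j (or_introl eq_refl)) as [i [<- Hp]].
    exists (i :: idx'). repeat split.
    + constructor; auto. intros Hi. now apply Hin in Hi.
    + simpl; now rewrite Hlen.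
    + destruct H0 as [<-|Hi]; [now left|right; now apply Hin].
    + destruct H0 as [<-|Hi]; auto. now apply Hin.
Qed.

Lemma rel_open_incl (M : MetricSpace) (A B U : M -> Prop) :
  (forall x, A x -> B x) -> rel_open M B U -> rel_open M A U.
Proof.
  intros HAB HU x Hx Hu. destruct (HU x (HAB x Hx) Hu) as [r [Hr H]].
  exists r; split; auto.
Qed.

Lemma is_open_rel_open (M : MetricSpace) (A U : M -> Prop) :
  is_open M U -> rel_open M A U.
Proof.
  intros HU x _ Hu. destruct (HU x Hu) as [r [Hr H]]. exists r; split; auto.
Qed.

Lemma rel_open_and (M : MetricSpace) (A U V : M -> Prop) :
  rel_open M A U -> rel_open M A V -> rel_open M A (fun x => U x /\ V x).
Proof.
  intros HU HV x Hx [Hu Hv].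
  destruct (HU x Hx Hu) as [r [Hr H]]. destruct (HV x Hx Hv) as [r' [Hr' H']].
  exists (Rmin r r'); split; [now apply Rmin_pos|]. intros y Hy Hd.
  pose proof (Rmin_l r r'). pose proof (Rmin_r r r').
  split; [apply H|apply H']; auto; lra.
Qed.

(* First refine a cover near [A] without touching the rest, then refine the
   result near [B], amalgamating the new sets along the refinement map so that
   the order on [A \ B] does not grow. *)
Lemma dim_le_union (M : MetricSpace) (A B : M -> Prop) n :
  is_closed M A -> is_closed M B -> dim_le M A n -> dim_le M B n ->
  dim_le M (fun x => A x \/ B x) n.
Proof.
  intros HA HB dA dB. apply dim_fam_le. apply dim_le_fam in dA, dB.
  intros k U HU Hc.
  pose (X := fun x => A x \/ B x).
  assert (AX : forall x, A x -> X x) by (unfold X; auto).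
  assert (BX : forall x, B x -> X x) by (unfold X; auto).
  destruct (dA k U) as [l [V [f [HV [HVc [HVr HVo]]]]]].
  { intros i Hi. apply rel_open_incl with X; auto. }
  { intros x Hx; auto. }
  (* Indices below [l] carry the enlarged refinement over [A]; index [l + i] carries [U i] with [A]
     removed. On [A] only the first kind occurs, so the order there is that of [V]. *)
  pose (W := fun i x => if lt_dec i l then open_ext M A (V i) x /\ U (f i) x
                        else U (i - l)%nat x /\ ~ A x).
  assert (HW : forall i, (i < l + k)%nat -> rel_open M X (W i)).
  { intros i Hi. unfold W. destruct (lt_dec i l).
    - apply rel_open_and; [apply is_open_rel_open, open_ext_open|].
      apply HU. now apply HVr.
    - apply rel_open_and; [apply HU; lia|]. now apply is_open_rel_open. }
  assert (HWc : forall x, X x -> exists i, (i < l + k)%nat /\ W i x).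
  { intros x Hx. destruct (excluded_middle_informative (A x)) as [a|na].
    - destruct (HVc x a) as [i [Hi Hv]]. exists i; split; [lia|].
      unfold W. destruct (lt_dec i l); [|lia]. split.
      + apply open_ext_incl; auto.
      + now apply HVr.
    - destruct (Hc x Hx) as [i [Hi Hu]]. exists (l + i)%nat; split; [lia|].
      unfold W. destruct (lt_dec (l + i) l); [lia|].
      now replace (l + i - l)%nat with i by lia. }
  assert (HWr : forall i, (i < l + k)%nat ->
            exists j, (j < k)%nat /\ forall x, W i x -> U j x).
  { intros i Hi. unfold W. destruct (lt_dec i l).
    - exists (f i). split; [now apply HVr|tauto].
    - exists (i - l)%nat. split; [lia|tauto]. }
  assert (HWo : forall x, A x -> order_at M (l + k) W x (S n)).
  { intros x Hx idx Hnd Hi.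
    apply (open_ext_order M A l V (S n) HVo x idx Hnd).
    intros i Hin. destruct (Hi i Hin) as [_ Hw]. unfold W in Hw.
    destruct (lt_dec i l); tauto. }
  destruct (dB (l + k)%nat W) as [l' [V' [f' [HV' [HVc' [HVr' HVo']]]]]].
  { intros i Hi. apply rel_open_incl with X; auto. }
  { intros x Hx; auto. }
  pose (T := fun i x => open_ext M B (V' i) x /\ W (f' i) x).
  (* Each [W j] keeps its part off [B] and, near [B], receives the new sets assigned to it. On [B]
     only the new sets count; everywhere [S' j] lies in [W j], which bounds the order on the rest of
     [A]. *)
  pose (S' := fun j x => (W j x /\ ~ B x) \/ exists i, (i < l')%nat /\ f' i = j /\ T i x).
  assert (HS : forall j x, S' j x -> W j x).
  { intros j x [[H _]|[i [_ [<- [_ H]]]]]; auto. }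
  assert (Hg : forall j, exists j', (j < l + k)%nat ->
            (j' < k)%nat /\ forall x, X x -> S' j x -> U j' x).
  { intros j. destruct (lt_dec j (l + k)) as [L|L]; [|exists O; lia].
    destruct (HWr j L) as [j' [Hj' H]]. exists j'; intros _; split; auto. }
  exists (l + k)%nat, S',
    (fun j => proj1_sig (constructive_indefinite_description _ (Hg j))).
  split; [|split; [|split]].
  - intros j Hj x Hx [[Hw Hb]|[i [Hi [E [He Hw]]]]].
    + destruct (rel_open_and M X (W j) (fun x => ~ B x)) with (x := x)
        as [r [Hr H]]; auto.
      { now apply is_open_rel_open. }
      exists r; split; auto. intros y Hy Hd. left; auto.
    + destruct (rel_open_and M X (open_ext M B (V' i)) (W (f' i))) with (x := x)
        as [r [Hr H]]; auto.
      { apply is_open_rel_open, open_ext_open. }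
      { apply HW. now apply HVr'. }
      exists r; split; auto. intros y Hy Hd. right. exists i. repeat split; auto.
      * now apply H.
      * now apply H.
  - intros x Hx. destruct (excluded_middle_informative (B x)) as [b|nb].
    + destruct (HVc' x b) as [i [Hi Hv]]. exists (f' i); split; [now apply HVr'|].
      right. exists i. repeat split; auto.
      * apply open_ext_incl; auto.
      * now apply HVr'.
    + destruct (HWc x Hx) as [j [Hj Hw]]. exists j; split; auto. now left.
  - intros j Hj.
    destruct (constructive_indefinite_description _ (Hg j)) as [j' Hj']; simpl.
    now apply Hj'.
  - intros x Hx idx Hnd Hi.
    destruct (excluded_middle_informative (B x)) as [b|nb].
    + destruct (NoDup_choose_preimages f' (fun i => (i < l')%nat /\ T i x) idx Hnd)
        as [idx' [Hnd' [<- Hin]]].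
      * intros j Hj. destruct (Hi j Hj) as [_ [[_ Hb]|[i [H1 [H2 H3]]]]]; [easy|].
        now exists i.
      * apply (open_ext_order M B l' V' (S n) HVo' x idx' Hnd').
        intros i Hii. destruct (Hin i Hii) as [_ [H1 [H2 _]]]. auto.
    + destruct Hx as [a|b]; [|easy].
      apply (HWo x a idx Hnd). intros j Hj. destruct (Hi j Hj). auto.
Qed.

Lemma dim_le_ext (M : MetricSpace) (A B : M -> Prop) n :
  (forall x, A x <-> B x) -> dim_le M A n -> dim_le M B n.
Proof.
  intros H. replace B with A; auto.
  apply functional_extensionality. intros x. now apply propositional_extensionality.
Qed.

Lemma dim_le_list_union (M : MetricSpace) (I : Type) (A : I -> M -> Prop) (l : list I) n :
  (forall i, In i l -> is_closed M (A i)) -> (forall i, In i l -> dim_le M (A i) n) ->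
  dim_le M (fun x => exists i, In i l /\ A i x) n.
Proof.
  intros Hcl Hdim.
  enough (is_closed M (fun x => exists i, In i l /\ A i x) /\
          dim_le M (fun x => exists i, In i l /\ A i x) n) by tauto.
  induction l as [|a l IH].
  - split.
    + intros x _. exists 1; split; [lra|]. intros y _ [i [[] _]].
    + intros Us _ _. exists nil. split; [|split; [|split]].
      * intros V [].
      * intros x [i [[] _]].
      * intros V [].
      * intros x [i [[] _]].
  - destruct IH as [IHc IHd]; [intros; apply Hcl; now right|intros; apply Hdim; now right|].
    assert (E : forall x, (A a x \/ exists i, In i l /\ A i x) <->
                          exists i, In i (a :: l) /\ A i x).
    { intros x; split.
      - intros [H|[i [Hi H]]]; [exists a|exists i]; simpl; auto.
      - intros [i [[<-|Hi] H]]; eauto. }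
    split.
    + intros x Hx.
      destruct (is_open_and M _ _ (Hcl a (or_introl eq_refl)) IHc x) as [r [Hr H]].
      { split; intros Hc; apply Hx, E; auto. }
      exists r; split; auto. intros y Hy Hc. apply H in Hy. apply E in Hc. tauto.
    + apply dim_le_ext with (1 := E). apply dim_le_union; auto.
      * apply Hcl; now left.
      * apply Hdim; now left.
Qed.

Definition image (X M : MetricSpace) (f : X -> M) (p : M) : Prop := exists x, f x = p.
Arguments image {X M} f p.

Lemma image_closed (X M : MetricSpace) (f : X -> M) :
  compact X -> cont f -> is_closed M (image f).
Proof.
  intros HX Hf p Hp.
  destruct (compact_uniform X HX (fun x d => d <= dist p (f x))) as [d [Hd H]].
  - intros; lra.
  - intros x.
    assert (Hpos : 0 < dist p (f x)).
    { destruct (dist_nonneg M p (f x)) as [L|E]; auto.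
      exfalso. apply Hp. exists x. symmetry. now apply dist_eq. }
    destruct (Hf x (dist p (f x) / 2)) as [d [Hd H]]; [lra|].
    exists (Rmin d (dist p (f x) / 2)).
    pose proof (Rmin_l d (dist p (f x) / 2)). pose proof (Rmin_r d (dist p (f x) / 2)).
    split; [apply Rmin_pos; lra|]. intros x' Hx.
    assert (Hx' : dist x x' < d) by lra. apply H in Hx'.
    pose proof (dist_tri M p (f x') (f x)). rewrite (dist_sym M (f x') (f x)) in *. lra.
  - exists d; split; auto. intros y Hy [x <-]. pose proof (H x). lra.
Qed.

(** * Small covers as a stable substitute for dimension *)

(** The members are open in [M], and their order is bounded at all points of [M], not only on [A].
    Hence the same family still serves when [A] is moved slightly. *)
Definition small_cover (n : nat) (M : MetricSpace) (A : M -> Prop) (eta : R) : Prop :=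
  exists (l : nat) (O : nat -> M -> Prop),
    (forall i, (i < l)%nat -> is_open M (O i)) /\
    (forall x, A x -> exists i, (i < l)%nat /\ O i x) /\
    (forall i, (i < l)%nat -> forall p q, O i p -> O i q -> dist p q < eta) /\
    (forall x, order_at M l O x (S n)).

Lemma small_cover_mono n (M : MetricSpace) (A A' : M -> Prop) eta eta' :
  (forall x, A' x -> A x) -> eta <= eta' ->
  small_cover n M A eta -> small_cover n M A' eta'.
Proof.
  intros HA He [l [O [H1 [H2 [H3 H4]]]]]. exists l, O. repeat split; auto.
  intros i Hi p q Hp Hq. apply Rlt_le_trans with eta; eauto.
Qed.

(** A cover of the image by balls of radius [eta / 2] is refined with order at most [n + 1].
    Extending the refinement to open sets of [M] keeps the order, and cutting with the balls keeps
    the diameters below [eta]. *)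
Lemma dim_le_small_cover n (X M : MetricSpace) (f : X -> M) eta :
  compact X -> cont f -> 0 < eta -> dim_le M (image f) n -> small_cover n M (image f) eta.
Proof.
  intros HX Hf Heta H. apply dim_le_fam in H.
  assert (Hd : forall x, exists d, 0 < d /\ forall x', dist x x' < d -> dist (f x) (f x') < eta / 2).
  { intros x. apply Hf; lra. }
  destruct (HX (fun x => proj1_sig (constructive_indefinite_description _ (Hd x)))) as [L HL].
  { intros x. destruct (constructive_indefinite_description _ (Hd x)); simpl; tauto. }
  pose (U := fun i p => match nth_error L i with Some c => dist (f c) p < eta / 2 | None => False end).
  assert (HU : forall i, is_open M (U i)).
  { intros i. unfold U. destruct (nth_error L i); [apply is_open_ball|intros x []]. }
  destruct (H (length L) U) as [l [V [g [HV [HVc [HVr HVo]]]]]].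
  - intros i _. now apply is_open_rel_open.
  - intros p [x <-]. destruct (HL x) as [t [Ht Hx]].
    destruct (constructive_indefinite_description _ (Hd t)) as [d [Hd0 Hdd]]; simpl in Hx.
    destruct (In_nth_error L t Ht) as [i Hi]. exists i; split.
    + apply nth_error_Some. now rewrite Hi.
    + unfold U. rewrite Hi. auto.
  - exists l, (fun i p => open_ext M (image f) (V i) p /\ U (g i) p). repeat split.
    + intros i Hi. apply is_open_and; auto. apply open_ext_open.
    + intros x Hx. destruct (HVc x Hx) as [i [Hi Hv]]. exists i. repeat split; auto.
      * apply open_ext_incl; auto.
      * now apply HVr.
    + intros i Hi p q [_ Hp] [_ Hq]. unfold U in Hp, Hq.
      destruct (nth_error L (g i)) as [c|]; [|easy].
      pose proof (dist_tri M p (f c) q). rewrite (dist_sym M p (f c)) in *. lra.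
    + intros x idx Hnd Hi. apply (open_ext_order M (image f) l V (S n) HVo x idx Hnd).
      intros i Hin. destruct (Hi i Hin) as [H1 [H2 _]]; auto.
Qed.

(** A cover whose mesh is a Lebesgue number of the given cover refines it. *)
Lemma small_cover_dim_le n (X M : MetricSpace) (f : X -> M) :
  compact X -> inhabited X -> cont f ->
  (forall eta, 0 < eta -> small_cover n M (image f) eta) -> dim_le M (image f) n.
Proof.
  intros HX [x0] Hf H. apply dim_fam_le. intros k U HU Hc.
  destruct (compact_uniform X HX (fun x d => exists i, (i < k)%nat /\
              forall p, image f p -> dist (f x) p < d -> U i p)) as [d [Hd HLeb]].
  - intros x d d' Hle [i [Hi Hp]]. exists i; split; auto. intros p Hp' Hd. apply Hp; auto; lra.
  - intros x. destruct (Hc (f x)) as [i [Hi Hu]]; [now exists x|].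
    destruct (HU i Hi (f x)) as [r [Hr Hb]]; auto; [now exists x|].
    destruct (Hf x (r / 2)) as [d [Hd Hfd]]; [lra|].
    exists (Rmin d (r / 2)). pose proof (Rmin_l d (r / 2)). pose proof (Rmin_r d (r / 2)).
    split; [apply Rmin_pos; lra|]. intros x' Hx. exists i; split; auto.
    intros p Hp Hd'. apply Hb; auto.
    assert (Hx' : dist x x' < d) by lra. apply Hfd in Hx'.
    pose proof (dist_tri M (f x) (f x') p). lra.
  - destruct (H d Hd) as [l [O [HO [HOc [HOd HOo]]]]].
    assert (Hg : forall i, exists j, (i < l)%nat ->
              (j < k)%nat /\ forall p, image f p -> O i p -> U j p).
    { intros i. destruct (lt_dec i l) as [L|L]; [|exists 0%nat; lia].
      destruct (excluded_middle_informative (exists x, O i (f x))) as [[x Hx]|Hn].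
      - destruct (HLeb x) as [j [Hj Hu]]. exists j; intros _; split; auto.
        intros p Hp Hop. apply Hu; auto. now apply (HOd i L).
      (* A member that misses the image may be assigned to any index; [x0] supplies one below
         [k]. *)
      - destruct (HLeb x0) as [j [Hj _]]. exists j; intros _; split; auto.
        intros p [x <-] Hop. exfalso; eauto. }
    exists l, O, (fun i => proj1_sig (constructive_indefinite_description _ (Hg i))).
    repeat split; auto.
    + intros i Hi. now apply is_open_rel_open, HO.
    + destruct (constructive_indefinite_description _ (Hg i)) as [j Hj]; simpl.
      now apply Hj.
    + destruct (constructive_indefinite_description _ (Hg i)) as [j Hj]; simpl.
      now apply Hj.
Qed.

(** The open sets covering the fiber image over [x] also cover the perturbed images over nearby
    points. Compactness of [Y] gives a margin along one fiber, that of [X] a margin common to all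
    fibers. *)
Lemma small_cover_open n (X Y M : MetricSpace) (f : prodM X Y -> M) eta :
  compact X -> compact Y -> cont f ->
  (forall x, small_cover n M (image (fun y => f (x, y))) eta) ->
  exists d, 0 < d /\ forall f' : prodM X Y -> M, (forall p, dist (f p) (f' p) <= d) ->
    forall x, small_cover n M (image (fun y => f' (x, y))) eta.
Proof.
  intros HX HY Hf H.
  destruct (compact_uniform X HX (fun x d => forall f' : Y -> M,
     (forall y, dist (f (x, y)) (f' y) < d) -> small_cover n M (image f') eta))
    as [d [Hd Hu]].
  - intros x d d' Hle H0 f' Hf'. apply H0. intros y. pose proof (Hf' y). lra.
  - intros x. destruct (H x) as [l [O [HO [HOc [HOd HOo]]]]].
    destruct (compact_uniform Y HY (fun y d => forall x' p,
       dist x x' < d -> dist (f (x', y)) p < d -> exists i, (i < l)%nat /\ O i p))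
      as [d [Hd Hu]].
    + intros y d d' Hle H0 x' p Hx Hp. apply (H0 x' p); lra.
    + intros y. destruct (HOc (f (x, y))) as [i [Hi Ho]]; [now exists y|].
      destruct (HO i Hi _ Ho) as [r [Hr Hb]].
      destruct (Hf (x, y) (r / 2)) as [d [Hd Hfd]]; [lra|].
      exists (Rmin d (r / 2)). pose proof (Rmin_l d (r / 2)). pose proof (Rmin_r d (r / 2)).
      split; [apply Rmin_pos; lra|]. intros y' Hy x' p Hx Hp.
      exists i; split; auto. apply Hb.
      assert (Hxy : dist (f (x, y)) (f (x', y')) < r / 2).
      { apply Hfd, prod_dist_lt; simpl; lra. }
      pose proof (dist_tri M (f (x, y)) (f (x', y')) p). lra.
    + exists d; split; auto. intros x' Hx f' Hf'.
      exists l, O. repeat split; auto. intros p [y <-]. now apply (Hu y x').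
  - exists (d / 2); split; [lra|]. intros f' Hf' x. apply (Hu x).
    intros y. pose proof (Hf' (x, y)). lra.
Qed.

(** * Infinite concatenation of homotopies *)

Definition homotopy_state (X M : MetricSpace) : Type := ((prodM X RM -> M) * R * R)%type.

(* [(F, e, tau)]: a homotopy [F] that is stationary from time [tau < 1] on,
   with a budget [e] left for all later modifications. *)
Definition valid_state (X M : MetricSpace) (g : X -> M) (E : R) (s : homotopy_state X M) : Prop :=
  let '(F, e, tau) := s in
  cont F /\ 0 < e /\ 0 <= tau < 1 /\ (forall x, F (x, 0) = g x) /\
  (forall x t, tau <= t -> F (x, t) = F (x, 1)) /\
  (forall x t, dist (F (x, t)) (g x) <= E - e).

(** The last clause secures [P] for every map within the remaining budget [e'] of the new end map,
    hence for the limit of all later steps. *)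
Definition state_step (X M : MetricSpace) (P : (X -> M) -> Prop) (s s' : homotopy_state X M) : Prop :=
  let '(F, e, _) := s in
  let '(F', e', _) := s' in
  e' <= e / 2 /\ (forall p, dist (F p) (F' p) <= e / 2) /\
  (forall f, (forall x, dist (F' (x, 1)) (f x) <= e') -> P f).

(** Since [F] rests from time [tau] on, a homotopy of its end map can be inserted in the idle time,
    from [tau] to the midpoint [tau'] of [tau] and 1. Earlier times are untouched, and later values
    move by at most [e / 2]. *)
Lemma state_step_exists (X M : MetricSpace) (g : X -> M) (P : (X -> M) -> Prop) E s :
  (forall f eta, cont f -> (forall x, dist (f x) (g x) <= E) -> 0 < eta ->
     exists H : prodM X RM -> M, cont H /\ (forall x, H (x, 0) = f x) /\
       P (fun x => H (x, 1)) /\ forall x t, dist (H (x, t)) (f x) <= eta) ->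
  (forall f, cont f -> P f -> exists d, 0 < d /\
     forall f', (forall x, dist (f x) (f' x) <= d) -> P f') ->
  valid_state X M g E s -> exists s', valid_state X M g E s' /\ state_step X M P s s'.
Proof.
  destruct s as [[F e] tau]. intros Hdense Hopen [HF [He [Htau [H0 [Hst Hbd]]]]].
  assert (Cf : forall (G : prodM X RM -> M) t, cont G -> cont (fun x => G (x, t))).
  { intros G t HG. apply (cont_comp X (prodM X RM) M (fun x => (x, t)) G); auto.
    apply (cont_pair X X RM); [apply cont_id|apply (cont_const X RM t)]. }
  destruct (Hdense (fun x => F (x, 1)) (e / 2)) as [H [HH [HH0 [HP Hd]]]]; auto.
  { intros x. apply Rle_trans with (1 := Hbd x 1). lra. }
  { lra. }
  destruct (Hopen (fun x => H (x, 1))) as [d [Hd0 Hdo]]; auto.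
  pose (tau' := (1 + tau) / 2).
  pose (F' := fun p : prodM X RM =>
    if Rle_dec (1 * snd p + - tau) 0 then F p
    else H (fst p, clamp (/ (tau' - tau) * snd p + - (tau / (tau' - tau))))).
  assert (Etau : forall t, / (tau' - tau) * t + - (tau / (tau' - tau)) = (t - tau) / (tau' - tau)).
  { intros t. unfold tau'. field. lra. }
  assert (Hw : 0 < tau' - tau) by (unfold tau'; lra).
  assert (HF' : cont F').
  { apply (cont_paste (prodM X RM) M (fun p => 1 * snd p + - tau) F
             (fun p => H (fst p, clamp (/ (tau' - tau) * snd p + - (tau / (tau' - tau)))))); auto.
    - apply (cont_comp (prodM X RM) RM RM snd (fun t => 1 * t + - tau));
        [apply cont_snd|apply cont_affine].
    - apply (cont_comp (prodM X RM) (prodM X RM) M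
               (fun p => (fst p, clamp (/ (tau' - tau) * snd p + - (tau / (tau' - tau))))) H); auto.
      apply (cont_pair (prodM X RM) X RM); [apply cont_fst|].
      apply (cont_comp (prodM X RM) RM RM snd
               (fun t => clamp (/ (tau' - tau) * t + - (tau / (tau' - tau)))));
        [apply cont_snd|].
      apply (cont_comp RM RM RM (fun t => / (tau' - tau) * t + - (tau / (tau' - tau))) clamp);
        [apply cont_affine|apply cont_clamp].
    (* At time [tau] both branches give the old end map: [F] is already at rest and [H] is just
       starting. *)
    - intros [x t]; simpl; intros Ht. rewrite Etau.
      replace (t - tau) with 0 by lra. unfold Rdiv; rewrite Rmult_0_l, clamp_0, HH0 by lra.
      apply Hst; lra. }
  assert (Hclose : forall p, dist (F p) (F' p) <= e / 2).
  { intros [x t]. unfold F'; cbn [fst snd]. destruct (Rle_dec (1 * t + - tau) 0).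
    - rewrite dist_refl; lra.
    - rewrite Hst, (dist_sym M) by lra. apply Hd. }
  assert (Hend : forall x t, tau' <= t -> F' (x, t) = H (x, 1)).
  { intros x t Ht. unfold F'; cbn [fst snd]. destruct (Rle_dec (1 * t + - tau) 0); [lra|].
    rewrite Etau, clamp_1; auto.
    apply Rmult_le_reg_r with (tau' - tau); auto.
    unfold Rdiv. rewrite Rmult_assoc, Rinv_l by lra. lra. }
  assert (Hlt : tau' < 1) by (unfold tau'; lra).
  (* The new budget respects both the margin [d] of [P] and the half of [e] that was not spent. *)
  exists (F', Rmin d (e / 2), tau').
  pose proof (Rmin_l d (e / 2)). pose proof (Rmin_r d (e / 2)).
  repeat split; auto.
  - apply Rmin_pos; lra.
  - lra.
  - intros x. unfold F'; cbn [fst snd]. destruct (Rle_dec (1 * 0 + - tau) 0); auto. lra.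
  - intros x t Ht. rewrite !Hend; auto. lra.
  - intros x t. pose proof (Hclose (x, t)). pose proof (Hbd x t).
    pose proof (dist_tri M (F' (x, t)) (F (x, t)) (g x)).
    rewrite (dist_sym M (F' (x, t)) (F (x, t))) in *. lra.
  - intros f Hf. apply Hdo. intros x. rewrite <- (Hend x 1) by lra.
    pose proof (Hf x). lra.
Qed.

(* A Baire category argument carried out along homotopies. *)
Lemma baire_homotopy (X M : MetricSpace) (g : X -> M) (P : nat -> (X -> M) -> Prop) E :
  complete M -> cont g -> 0 < E ->
  (forall k f eta, cont f -> (forall x, dist (f x) (g x) <= E) -> 0 < eta ->
     exists H : prodM X RM -> M, cont H /\ (forall x, H (x, 0) = f x) /\
       P k (fun x => H (x, 1)) /\ forall x t, dist (H (x, t)) (f x) <= eta) ->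
  (forall k f, cont f -> P k f -> exists d, 0 < d /\
     forall f', (forall x, dist (f x) (f' x) <= d) -> P k f') ->
  exists H : prodM X RM -> M, cont H /\ (forall x, H (x, 0) = g x) /\
    (forall k, P k (fun x => H (x, 1))) /\ forall x t, dist (H (x, t)) (g x) <= E.
Proof.
  intros HM Hg HE Hdense Hopen.
  assert (Hstep : forall k s, exists s', valid_state X M g E s ->
            valid_state X M g E s' /\ state_step X M (P k) s s').
  { intros k s. destruct (excluded_middle_informative (valid_state X M g E s)) as [v|nv].
    - destruct (state_step_exists X M g (P k) E s) as [s' Hs']; eauto.
    - now exists s. }
  pose (next := fun k s => proj1_sig (constructive_indefinite_description _ (Hstep k s))).
  (* The start is the constant homotopy at [g], with the whole budget [E] unspent. *)
  pose (st := nat_rect (fun _ => homotopy_state X M) (fun p => g (fst p), E, 0) next).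
  assert (Hval : forall k, valid_state X M g E (st k)).
  { induction k as [|k IH].
    - simpl. repeat split; auto; try lra.
      + apply (cont_comp (prodM X RM) X M fst g); auto. apply cont_fst.
      + intros x _. rewrite dist_refl; lra.
    - change (st (S k)) with (next k (st k)). unfold next.
      destruct (constructive_indefinite_description _ (Hstep k (st k))) as [s' Hs']; simpl.
      now apply Hs'. }
  assert (Hrel : forall k, state_step X M (P k) (st k) (st (S k))).
  { intros k. change (st (S k)) with (next k (st k)). unfold next.
    destruct (constructive_indefinite_description _ (Hstep k (st k))) as [s' Hs']; simpl.
    now apply Hs'. }
  pose (F := fun k => fst (fst (st k))). pose (e := fun k => snd (fst (st k))).
  assert (HF : forall k, cont (F k) /\ 0 < e k /\ (forall x, F k (x, 0) = g x)).
  { intros k. pose proof (Hval k) as Hv. unfold F, e.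
    destruct (st k) as [[F0 e0] t0]. simpl in *. tauto. }
  assert (HR : forall k, e (S k) <= e k / 2 /\
            (forall p, dist (F k p) (F (S k) p) <= e k / 2) /\
            (forall f, (forall x, dist (F (S k) (x, 1)) (f x) <= e (S k)) -> P k f)).
  { intros k. pose proof (Hrel k) as Hr. unfold F, e.
    destruct (st k) as [[F0 e0] t0], (st (S k)) as [[F1 e1] t1]. exact Hr. }
  (* Convergence is uniform over all times, so continuity at time 1, where the switching times may
     accumulate, needs no separate argument. *)
  destruct (uniform_limit (prodM X RM) M F e) as [H [HH Hlim]]; auto.
  - intros k; apply HF.
  - intros k; apply HR.
  - intros k; apply HF.
  - intros k x; apply HR.
  - exists H. repeat split; auto.
    + intros x. apply dist_eq, Rle_antisym; [|apply dist_nonneg].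
      apply Rnot_lt_le. intros Hlt.
      destruct (halving_small e) with (eps := dist (H (x, 0)) (g x)) as [N HN]; auto.
      * intros k; apply HF.
      * intros k; apply HR.
      * pose proof (Hlim N (x, 0)) as Hl.
        rewrite (proj2 (proj2 (HF N))), (dist_sym M) in Hl. lra.
    + intros k. apply (HR k). intros x. apply Hlim.
    + intros x t. rewrite (dist_sym M). apply (Hlim O (x, t)).
Qed.

(** * Local modification on a box *)

Lemma cont_map_cont (M : MetricSpace) m n (g : cube m -> cube n -> M) :
  cont_map M m n g <->
  cont (X := prodM (cubeM m) (cubeM n)) (fun p => g (fst p) (snd p)).
Proof.
  split.
  - intros H [z y] eps He. destruct (H z y eps He) as [d [Hd Hc]].
    exists d; split; auto. intros [z' y'] Hp. apply prod_dist_lt in Hp.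
    apply Hc; apply close_dist; tauto.
  - intros H z y eps He. destruct (H (z, y) eps He) as [d [Hd Hc]].
    exists d; split; auto. intros z' y' Hz Hy. apply (Hc (z', y')).
    apply prod_dist_lt. split; now apply close_dist.
Qed.

Lemma cont_homotopy_clamp (M : MetricSpace) m n (h : cube m -> cube n -> R -> M) :
  cont_homotopy M m n h ->
  cont (X := prodM (prodM (cubeM m) (cubeM n)) RM)
    (fun p => h (fst (fst p)) (snd (fst p)) (clamp (snd p))).
Proof.
  intros H [[z y] t] eps He.
  destruct (H z y (clamp t) (clamp_range t) eps He) as [d [Hd Hc]].
  exists d; split; auto. intros [[z' y'] t'] Hp.
  apply prod_dist_lt in Hp. destruct Hp as [Hp Ht]. apply prod_dist_lt in Hp.
  apply Hc; try apply clamp_range; try (apply close_dist; tauto).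
  apply Rle_lt_trans with (1 := clamp_lipschitz _ _). exact Ht.
Qed.

Lemma cont_cont_homotopy (M : MetricSpace) m n
  (H : prodM (prodM (cubeM m) (cubeM n)) RM -> M) :
  cont H -> cont_homotopy M m n (fun z y t => H ((z, y), t)).
Proof.
  intros HH z y t Ht eps He. destruct (HH ((z, y), t) eps He) as [d [Hd Hc]].
  exists d; split; auto. intros z' y' t' Hz Hy Ht' Hd'. apply Hc.
  apply prod_dist_lt; split; [|exact Hd'].
  apply prod_dist_lt; split; now apply close_dist.
Qed.

(* Parametrisation of the box of radius [s] around [a], cut off by the cube;
   because of the cut-off [unbox] is only a section of [box]. *)
Definition box (k : nat) (a : cubeM k) (s : R) (u : cubeM k) : cubeM k :=
  mkcube k (fun i => proj1_sig a i - s + 2 * s * proj1_sig u i).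

Definition unbox (k : nat) (a : cubeM k) (s : R) (x : cubeM k) : cubeM k :=
  mkcube k (fun i => (proj1_sig x i - proj1_sig a i + s) / (2 * s)).

Arguments box {k} a s u.
Arguments unbox {k} a s x.

Lemma box_unbox k (a x : cubeM k) s : 0 < s -> dist a x <= s -> box a s (unbox a s x) = x.
Proof.
  intros Hs Hd. apply cube_ext. intros i Hi.
  unfold box, unbox. rewrite !mkcube_coord by assumption.
  pose proof (coord_dist k a x i Hi) as Hc.
  pose proof (proj1 (proj2_sig x i)) as Hx.
  assert (Hab : - s <= proj1_sig a i - proj1_sig x i <= s).
  { revert Hc. unfold Rabs; destruct Rcase_abs; lra. }
  rewrite (clamp_id ((_ - _ + s) / _)).
  - replace (proj1_sig a i - s + 2 * s * ((proj1_sig x i - proj1_sig a i + s) / (2 * s)))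
      with (proj1_sig x i) by (field; lra).
    now apply clamp_id.
  - split.
    + apply Rmult_le_pos; [lra|]. left; apply Rinv_0_lt_compat; lra.
    + apply Rmult_le_reg_r with (2 * s); [lra|].
      unfold Rdiv. rewrite Rmult_assoc, Rinv_l by lra. lra.
Qed.

Lemma box_dist k (a u : cubeM k) s : 0 < s -> dist a (box a s u) <= s.
Proof.
  intros Hs. apply rmax_le; [lra|]. intros i Hi. unfold box.
  rewrite mkcube_coord by assumption.
  pose proof (proj1 (proj2_sig a i)) as Ha.
  pose proof (proj1 (proj2_sig u i)) as Hu.
  rewrite <- (clamp_id (proj1_sig a i)) at 1 by assumption.
  apply Rle_trans with (1 := clamp_lipschitz _ _). apply Rabs_le. nra.
Qed.

Lemma cont_box k (a : cubeM k) s : 0 < s -> cont (box a s).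
Proof.
  intros Hs. apply cont_lipschitz with (L := 2 * s); [lra|].
  intros u u'. apply mkcube_dist.
  - apply Rmult_le_pos; [lra|apply dist_nonneg].
  - intros i Hi.
    replace (proj1_sig a i - s + 2 * s * proj1_sig u i -
             (proj1_sig a i - s + 2 * s * proj1_sig u' i))
      with (2 * s * (proj1_sig u i - proj1_sig u' i)) by ring.
    rewrite Rabs_mult, (Rabs_right (2 * s)) by lra.
    apply Rmult_le_compat_l; [lra|]. now apply coord_dist.
Qed.

Lemma cont_unbox k (a : cubeM k) s : 0 < s -> cont (unbox a s).
Proof.
  intros Hs.
  assert (Hi : 0 < / (2 * s)) by (apply Rinv_0_lt_compat; lra).
  apply cont_lipschitz with (L := / (2 * s)); auto.
  intros x x'. apply mkcube_dist.
  - apply Rmult_le_pos; [lra|apply dist_nonneg].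
  - intros i Hik.
    replace ((proj1_sig x i - proj1_sig a i + s) / (2 * s) -
             (proj1_sig x' i - proj1_sig a i + s) / (2 * s))
      with (/ (2 * s) * (proj1_sig x i - proj1_sig x' i)) by (field; lra).
    rewrite Rabs_mult, (Rabs_right (/ (2 * s))) by lra.
    apply Rmult_le_compat_l; [lra|]. now apply coord_dist.
Qed.

Lemma cont_proj1_sig (M : MetricSpace) (U : M -> Prop) :
  cont (X := subspace M U) (Y := M) (fun x => proj1_sig x).
Proof. intros x eps He. now exists eps. Qed.

(* The homotopy provided by [FAP] on the box of radius [2 r] is run only up to
   time [phi], which is 1 on the box of radius [r] and 0 on the boundary of the
   large box; so it extends by the constant homotopy. *)
Lemma local_modification n m (M : MetricSpace) (U : M -> Prop)
  (f : prodM (cubeM m) (cubeM n) -> M) (a : cubeM m) (b : cubeM n) r eta :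
  FAP n (subspace M U) -> cont f -> 0 < r -> 0 < eta ->
  (forall x, dist (m := prodM (cubeM m) (cubeM n)) (a, b) x <= 2 * r -> U (f x)) ->
  exists H : prodM (prodM (cubeM m) (cubeM n)) RM -> M,
    cont H /\ (forall x, H (x, 0) = f x) /\ (forall x t, dist (H (x, t)) (f x) <= eta) /\
    forall u eta', 0 < eta' ->
      small_cover n M (image (fun v : cubeM n => H ((box a r u, box b r v), 1))) eta'.
Proof.
  intros HFAP Hf Hr Heta HU.
  set (X := prodM (cubeM m) (cubeM n)) in *.
  assert (Hr2 : 0 < 2 * r) by lra.
  assert (HUg : forall u v, U (f (box a (2 * r) u, box b (2 * r) v))).
  { intros u v. apply HU, prod_dist_le; simpl fst; simpl snd.
    split; now apply box_dist. }
  pose (g := fun u v => exist U _ (HUg u v) : subspace M U).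
  destruct (HFAP eta Heta m g) as [g' [Hg' [[h [Hh [Hh0 [Hh1 Hhd]]]] Hdim]]].
  { apply cont_map_cont.
    apply (cont_comp X X M (fun p => (box a (2 * r) (fst p), box b (2 * r) (snd p))) f); auto.
    apply (cont_pair X (cubeM m) (cubeM n)).
    - apply (cont_comp X (cubeM m) (cubeM m) fst); [apply cont_fst|now apply cont_box].
    - apply (cont_comp X (cubeM n) (cubeM n) snd); [apply cont_snd|now apply cont_box]. }
  (* The cut-off is [2 - dist / r], truncated to the unit interval. *)
  pose (phi := fun x : X => clamp (- / r * dist (m := X) (a, b) x + 2)).
  pose (F1 := fun p : prodM X RM =>
    proj1_sig (h (unbox a (2 * r) (fst (fst p))) (unbox b (2 * r) (snd (fst p)))
                 (clamp (clamp (snd p) * phi (fst p))))).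
  pose (H := fun p : prodM X RM =>
    if Rle_dec (1 * dist (m := X) (a, b) (fst p) + - (2 * r)) 0 then F1 p else f (fst p)).
  assert (Hphi : cont (X := X) (Y := RM) phi).
  { apply (cont_comp X RM RM (fun x => - / r * dist (m := X) (a, b) x + 2) clamp);
      [|apply cont_clamp].
    apply (cont_comp X RM RM (fun x => dist (m := X) (a, b) x) (fun t => - / r * t + 2));
      [apply cont_dist|apply cont_affine]. }
  assert (HF1 : cont F1).
  { apply (cont_comp (prodM X RM) (prodM X RM) M
      (fun p => ((unbox a (2 * r) (fst (fst p)), unbox b (2 * r) (snd (fst p))),
                 clamp (snd p) * phi (fst p)))
      (fun q => proj1_sig (h (fst (fst q)) (snd (fst q)) (clamp (snd q))))).
    - apply (cont_pair (prodM X RM) X RM).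
      + apply (cont_pair (prodM X RM) (cubeM m) (cubeM n)).
        * apply (cont_comp (prodM X RM) X (cubeM m) fst (fun x => unbox a (2 * r) (fst x)));
            [apply cont_fst|].
          apply (cont_comp X (cubeM m) (cubeM m) fst); [apply cont_fst|now apply cont_unbox].
        * apply (cont_comp (prodM X RM) X (cubeM n) fst (fun x => unbox b (2 * r) (snd x)));
            [apply cont_fst|].
          apply (cont_comp X (cubeM n) (cubeM n) snd); [apply cont_snd|now apply cont_unbox].
      + apply (cont_mult (prodM X RM) (fun p => clamp (snd p)) (fun p => phi (fst p))).
        * apply (cont_comp (prodM X RM) RM RM snd clamp); [apply cont_snd|apply cont_clamp].
        * apply (cont_comp (prodM X RM) X RM fst phi); [apply cont_fst|exact Hphi].
        * intros p. apply Rabs_le. pose proof (clamp_range (snd p)). lra.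
        * intros p. apply Rabs_le. unfold phi.
          pose proof (clamp_range (- / r * dist (m := X) (a, b) (fst p) + 2)). lra.
    - apply (cont_comp (prodM X RM) (subspace M U) M
               (fun q => h (fst (fst q)) (snd (fst q)) (clamp (snd q))) (fun x => proj1_sig x)).
      + apply cont_homotopy_clamp, Hh.
      + apply cont_proj1_sig. }
  (* Within distance [2 * r] of the centre, [box] undoes [unbox], so time 0 of the local homotopy is
     [f] itself. *)
  assert (Hh0' : forall x : X, dist (m := X) (a, b) x <= 2 * r ->
            proj1_sig (h (unbox a (2 * r) (fst x)) (unbox b (2 * r) (snd x)) 0) = f x).
  { intros [z y] Hx. apply prod_dist_le in Hx. destruct Hx as [Hz Hy]. simpl in Hz, Hy.
    rewrite Hh0. unfold g; cbn [proj1_sig fst snd].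
    now rewrite !box_unbox. }
  assert (HH : cont H).
  { apply (cont_paste (prodM X RM) M
             (fun p => 1 * dist (m := X) (a, b) (fst p) + - (2 * r)) F1 (fun p => f (fst p))).
    - apply (cont_comp (prodM X RM) RM RM (fun p => dist (m := X) (a, b) (fst p))
               (fun t => 1 * t + - (2 * r))); [|apply cont_affine].
      apply (cont_comp (prodM X RM) X RM fst (fun x => dist (m := X) (a, b) x));
        [apply cont_fst|apply cont_dist].
    - exact HF1.
    - apply (cont_comp (prodM X RM) X M fst f); [apply cont_fst|exact Hf].
    - intros [x t]; cbn [fst snd]; intros Hd. unfold F1, phi; cbn [fst snd].
      assert (E : dist (m := X) (a, b) x = 2 * r) by lra.
      rewrite E. replace (- / r * (2 * r) + 2) with 0 by (field; lra).
      rewrite (clamp_0 0), Rmult_0_r, (clamp_0 0) by lra. apply Hh0'; lra. }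
  exists H. split; [exact HH|split; [|split]].
  - intros x. unfold H, F1; cbn [fst snd].
    destruct (Rle_dec (1 * dist (m := X) (a, b) x + - (2 * r)) 0); auto.
    rewrite (clamp_0 0), Rmult_0_l, (clamp_0 0) by lra. apply Hh0'; lra.
  - intros x t. unfold H, F1; cbn [fst snd].
    destruct (Rle_dec (1 * dist (m := X) (a, b) x + - (2 * r)) 0).
    + rewrite <- (Hh0' x) by lra.
      destruct (Hhd (unbox a (2 * r) (fst x)) (unbox b (2 * r) (snd x))) as [q [Hq Hqd]].
      apply Rle_trans with q; [|lra]. apply Hqd; [apply clamp_range|lra].
    + rewrite dist_refl; lra.
  - intros u eta' Heta'.
    pose (k := fun v : cubeM n => proj1_sig (g' (unbox a (2 * r) (box a r u)) v)).
    assert (Hk : cont k).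
    { apply (cont_comp (cubeM n) (subspace M U) M
               (fun v => g' (unbox a (2 * r) (box a r u)) v) (fun x => proj1_sig x));
        [|apply cont_proj1_sig].
      apply (cont_comp (cubeM n) X (subspace M U)
               (fun v => (unbox a (2 * r) (box a r u), v)) (fun p => g' (fst p) (snd p))).
      - apply (cont_pair (cubeM n) (cubeM m) (cubeM n)); [apply cont_const|apply cont_id].
      - now apply cont_map_cont. }
    (* Over the small box [phi] is 1, so what is seen of the fiber at time 1 is part of a full fiber
       of [g']. Small covers pass to subsets. *)
    apply small_cover_mono with (image k) eta'; [|lra|].
    + intros p [v <-]. exists (unbox b (2 * r) (box b r v)).
      unfold k, H, F1; cbn [fst snd].
      assert (Hd : dist (m := X) (a, b) (box a r u, box b r v) <= r).
      { apply prod_dist_le; simpl fst; simpl snd. split; now apply box_dist. }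
      destruct (Rle_dec (1 * dist (m := X) (a, b) (box a r u, box b r v) + - (2 * r)) 0) as [|N];
        [|exfalso; apply N; lra].
      unfold phi. rewrite (clamp_1 1) by lra.
      rewrite (clamp_1 (- / r * _ + 2)).
      * rewrite Rmult_1_l, (clamp_1 1), Hh1 by lra. reflexivity.
      * apply Rmult_le_compat_l with (r := / r) in Hd;
          [|left; now apply Rinv_0_lt_compat].
        rewrite Rinv_l in Hd by lra. lra.
    + apply dim_le_small_cover; auto; [apply cube_compact|].
      apply dim_le_ext with (2 := dim_le_isometry (subspace M U) M (fun x => proj1_sig x) _ n
                                    (fun x y => eq_refl) (Hdim (unbox a (2 * r) (box a r u)))).
      intros p; split.
      * intros [x [[v <-] <-]]. now exists v.
      * intros [v <-]. exists (g' (unbox a (2 * r) (box a r u)) v). eauto.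
Qed.

(** * From the local property to the global one *)

Lemma FAP_of_local n (M : MetricSpace) :
  complete M ->
  (forall z : M, exists U : M -> Prop, neighborhood M z U /\ FAP n (subspace M U)) ->
  FAP n M.
Proof.
  intros HM Hloc eps Heps m g Hg. apply cont_map_cont in Hg.
  set (X := prodM (cubeM m) (cubeM n)) in *.
  pose (g0 := fun p : X => g (fst p) (snd p)). change (cont g0) in Hg.
  assert (HX : locally_uniform_is_uniform X)
    by (apply uniform_prod; apply compact_uniform, cube_compact).
  (* The number [d] serves twice: as the size of a region in the cube with one common [U], and as
     the amount by which the map may move while staying in [U]. *)
  destruct (HX (fun x d => exists U, FAP n (subspace M U) /\
     forall x' p, dist x x' < d -> dist (g0 x') p < d -> U p)) as [d [Hd HU]].
  { intros x d d' Hle [U [HU H]]. exists U; split; auto.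
    intros x' p Hx Hp. apply (H x' p); lra. }
  { intros x. destruct (Hloc (g0 x)) as [U [[s [Hs HUs]] HFAP]].
    destruct (Hg x (s / 2)) as [d [Hd Hc]]; [lra|].
    exists (Rmin (d / 2) (s / 2)).
    pose proof (Rmin_l (d / 2) (s / 2)). pose proof (Rmin_r (d / 2) (s / 2)).
    split; [apply Rmin_pos; lra|]. intros x1 Hx1. exists U; split; auto.
    intros x' p Hx Hp. apply HUs.
    assert (Hx' : dist x x' < d) by (pose proof (dist_tri X x x1 x'); lra).
    apply Hc in Hx'. pose proof (dist_tri M (g0 x) (g0 x') p). lra. }
  (* With this choice the large box, of radius [2 * r], stays strictly inside the region of radius
     [d]. *)
  pose (r := d / 3). assert (Hr : 0 < r) by (unfold r; lra).
  destruct (cube_compact m (fun _ => r)) as [lm Hlm]; [auto|].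
  destruct (cube_compact n (fun _ => r)) as [ln Hln]; [auto|].
  pose (l := list_prod lm ln).
  (* Cycling through the list makes every box recur infinitely often, while the mesh [/ INR (S k)]
     demanded in [P] tends to 0. *)
  pose (center := fun k => nth (k mod length l) l (mkcube m (fun _ => 0), mkcube n (fun _ => 0))).
  pose (P := fun k (f : X -> M) => forall u,
    small_cover n M (image (fun v : cubeM n =>
      f (box (fst (center k)) r u, box (snd (center k)) r v))) (/ INR (S k))).
  assert (Hinv : forall k, 0 < / INR (S k))
    by (intros k; apply Rinv_0_lt_compat, lt_0_INR; lia).
  (* Tracks stay within [E] of [g0], so their diameter is at most [2 * E < eps]; and [E < d] keeps
     every intermediate map inside the sets [U]. *)
  pose (E := Rmin (eps / 3) (d / 2)).
  pose proof (Rmin_l (eps / 3) (d / 2)) as HE1. pose proof (Rmin_r (eps / 3) (d / 2)) as HE2.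
  fold E in HE1, HE2.
  destruct (baire_homotopy X M g0 P E) as [H [HH [H0 [H1 Hbd]]]]; auto.
  { apply Rmin_pos; lra. }
  { intros k f eta Hf Hclose Heta.
    destruct (HU (center k)) as [U [HFAP HUc]].
    destruct (local_modification n m M U f (fst (center k)) (snd (center k)) r eta)
      as [H [HH [H0 [Hbd Hsc]]]]; auto.
    - intros x Hx. apply (HUc x).
      + rewrite <- surjective_pairing in Hx. unfold r in Hx. fold X in Hx. lra.
      + rewrite (dist_sym M). pose proof (Hclose x). lra.
    - exists H. split; [exact HH|]. split; [exact H0|]. split; [|exact Hbd].
      intros u. now apply Hsc. }
  { intros k f Hf HP.
    pose (B := fun p : X => (box (fst (center k)) r (fst p), box (snd (center k)) r (snd p)) : X).
    destruct (small_cover_open n (cubeM m) (cubeM n) M (fun p => f (B p)) (/ INR (S k)))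
      as [d' [Hd' Hopen]]; auto using cube_compact.
    - apply (cont_comp X X M B f); auto.
      apply (cont_pair X (cubeM m) (cubeM n)).
      + apply (cont_comp X (cubeM m) (cubeM m) fst); [apply cont_fst|now apply cont_box].
      + apply (cont_comp X (cubeM n) (cubeM n) snd); [apply cont_snd|now apply cont_box].
    - exists d'; split; auto. intros f' Hf' u.
      apply (Hopen (fun p => f' (B p))). intros p; apply Hf'. }
  assert (HH1 : cont (fun x : X => H (x, 1))).
  { apply (cont_comp X (prodM X RM) M (fun x => (x, 1)) H); auto.
    apply (cont_pair X X RM); [apply cont_id|apply (cont_const X RM 1)]. }
  exists (fun z y => H ((z, y), 1)). split; [|split].
  - apply cont_map_cont.
    apply (cont_comp X X M (fun p => (fst p, snd p)) (fun x => H (x, 1))); auto.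
    apply (cont_pair X (cubeM m) (cubeM n)); [apply cont_fst|apply cont_snd].
  - exists (fun z y t => H ((z, y), t)). split; [|split; [|split]].
    + now apply cont_cont_homotopy.
    + intros z y. apply H0.
    + reflexivity.
    + intros z y. exists (2 * E); split; [lra|]. intros t t' _ _.
      apply Rle_trans with (1 := dist_tri M _ (g0 (z, y)) _).
      apply Rle_trans with (E + E); [|lra]. apply Rplus_le_compat; [apply Hbd|].
      rewrite (dist_sym M). apply Hbd.
  - intros z. destruct (Hlm z) as [a [Ha Haz]].
    assert (Hc : forall b, cont (fun v : cubeM n => H ((z, box b r v), 1))).
    { intros b. apply (cont_comp (cubeM n) X M (fun v => (z, box b r v)) (fun x => H (x, 1))); auto.
      apply (cont_pair (cubeM n) (cubeM m) (cubeM n)); [apply cont_const|now apply cont_box]. }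
    (* The fiber image over [z] is the union, over the centres [b] in the second factor, of the
       compact images of the boxes around [b]. *)
    apply dim_le_ext with
      (A := fun p => exists b, In b ln /\ image (fun v : cubeM n => H ((z, box b r v), 1)) p).
    + intros p; split.
      * intros [b [_ [v <-]]]. now exists (box b r v).
      * intros [y <-]. destruct (Hln y) as [b [Hb Hby]]. exists b; split; auto.
        exists (unbox b r y). rewrite box_unbox; auto. lra.
    + apply dim_le_list_union.
      * intros b _. apply image_closed; auto using cube_compact.
      * intros b Hb. apply small_cover_dim_le; auto using cube_compact.
        intros eta Heta.
        destruct (archimed_cor1 eta Heta) as [q [Hq Hq0]].
        destruct (In_nth l (a, b) (mkcube m (fun _ => 0), mkcube n (fun _ => 0)))
          as [i [Hi Ei]]; [now apply in_prod|].
        (* This stage treats the box around [(a, b)]. As [l] is nonempty, its mesh is at most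
           [/ INR q], hence below [eta]. *)
        pose proof (H1 (i + q * length l)%nat) as HP. unfold P, center in HP.
        rewrite Nat.Div0.mod_add, Nat.mod_small, Ei in HP by assumption.
        apply small_cover_mono with (3 := HP (unbox a r z)).
        -- intros p [v <-]. exists v. cbn [fst snd]. rewrite box_unbox; auto. lra.
        -- apply Rle_trans with (/ INR q); [|lra].
           apply Rinv_le_contravar; [now apply lt_0_INR|]. apply le_INR. nia.
Qed.

(** Needed because the subspace of all points of [M] is only an isometric copy of [M]: its points
    carry proofs. *)
Lemma FAP_isometry n (M N : MetricSpace) (iota : M -> N) (pi : N -> M) :
  (forall x y, dist (iota x) (iota y) = dist x y) -> (forall y, iota (pi y) = y) ->
  FAP n M -> FAP n N.
Proof.
  intros Hiso Hs H eps Heps m g Hg.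
  assert (Hpi : forall x y, dist (pi x) (pi y) = dist x y)
    by (intros; now rewrite <- Hiso, !Hs).
  destruct (H eps Heps m (fun z y => pi (g z y)))
    as [g' [Hg' [[h [Hh [Hh0 [Hh1 Hhd]]]] Hdim]]].
  - intros z y e He. destruct (Hg z y e He) as [d [Hd Hc]]. exists d; split; auto.
    intros. rewrite Hpi; auto.
  - exists (fun z y => iota (g' z y)). split; [|split].
    + intros z y e He. destruct (Hg' z y e He) as [d [Hd Hc]]. exists d; split; auto.
      intros. rewrite Hiso; auto.
    + exists (fun z y t => iota (h z y t)). split; [|split; [|split]].
      * intros z y t Ht e He. destruct (Hh z y t Ht e He) as [d [Hd Hc]].
        exists d; split; auto. intros. rewrite Hiso; auto.
      * intros z y. now rewrite Hh0.
      * intros z y. now rewrite Hh1.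
      * intros z y. destruct (Hhd z y) as [r [Hr Hb]]. exists r; split; auto.
        intros. rewrite Hiso; auto.
    + intros z. apply dim_le_ext with (2 := dim_le_isometry M N iota _ n Hiso (Hdim z)).
      intros p; split.
      * intros [x [[y <-] <-]]. now exists y.
      * intros [y <-]. exists (g' z y). eauto.
Qed.

Theorem theorem2p7 (n : nat) (M : MetricSpace) (Mcomplete : complete M) :
  FAP n M <->
  (forall z : M, exists U : M -> Prop,
     neighborhood M z U /\ FAP n (subspace M U)).
Proof.
  split.
  - intros H z. exists (fun _ => True). split.
    + exists 1; split; [lra|auto].
    + apply (FAP_isometry n M (subspace M (fun _ => True))
               (fun x => exist (fun _ => True) x I) (fun y => proj1_sig y)); auto.
      intros [y []]; reflexivity.
  - now apply FAP_of_local.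
Qed.
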